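(* Let $(\alpha,\eta)$ be a contact pair of type $(h,k)$ on a manifold $M$. The Reeb vector fields $X_\alpha$, $X_\eta$ of $(\alpha,\eta)$ commute, i.e. $[X_\alpha,X_\eta]=0$, and satisfy $$\eta(X_\alpha)=0,\quad i(X_\alpha)d\alpha=i(X_\alpha)d\eta=0,$$ $$\alpha(X_\eta)=0,\quad i(X_\eta)d\alpha=i(X_\eta)d\eta=0.$$
   Context: All objects are $C^\infty$. A contact pair of type $(h,k)$ (with $h,k\ge 0$ integers) on a $(2h+2k+2)$-dimensional manifold $M$ is a pair $(\alpha,\eta)$ of 1-forms on $M$ such that $d\alpha^{h+1}=0$, $d\eta^{k+1}=0$, and $\alpha\wedge d\alpha^{h}\wedge\eta\wedge d\eta^{k}$ is a volume form on $M$ (nowhere zero); $d\alpha^{j}$ means $(d\alpha)^{j}$. The Reeb vector fields of the contact pair are the unique vector fields $X_\alpha$, $X_\eta$ with $\alpha(X_\alpha)=1$, $i(X_\alpha)(d\alpha^{h}\wedge\eta\wedge d\eta^{k})=0$, and $\eta(X_\eta)=1$, $i(X_\eta)(\alpha\wedge d\alpha^{h}\wedge d\eta^{k})=0$, where $i(X)$ denotes interior product. *)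

(* Defs.v *)
From HB Require Import structures.
From mathcomp Require Import all_boot all_order all_algebra all_fingroup.
From mathcomp Require Import all_classical all_reals all_analysis.

Set Implicit Arguments.
Unset Strict Implicit.
Unset Printing Implicit Defensive.

Import Order.TTheory GRing.Theory Num.Theory.
Import numFieldNormedType.Exports.

Local Open Scope classical_set_scope.
Local Open Scope ring_scope.

(* f is C^oo on the open set U: all its iterated directional derivatives are
   differentiable, hence continuous, at every point of U. *)
Definition smooth_on (R : realType) (V W : normedModType R)
    (U : set V) (f : V -> W) : Prop :=
  forall (vs : seq V) (x : V), U x ->
    differentiable (foldr (fun v (g : V -> W) y => 'D_v g y) f vs) x.

(* coord is only meaningful on chart_dom, and param, its inverse, on the image
   of chart_dom; both are total functions with arbitrary values elsewhere. *)
Record chart (R : realType) (M : topologicalType) (n : nat) := Chart {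
  chart_dom : set M;
  coord : M -> 'rV[R]_n;
  param : 'rV[R]_n -> M
}.

Definition chart_im (R : realType) (M : topologicalType) (n : nat)
    (c : chart R M n) : set 'rV[R]_n := coord c @` chart_dom c.

Definition is_chart (R : realType) (M : topologicalType) (n : nat)
    (c : chart R M n) : Prop :=
  [/\ open (chart_dom c), open (chart_im c),
      {within chart_dom c, continuous (coord c)},
      {within chart_im c, continuous (param c)} &
      forall p, chart_dom c p -> param c (coord c p) = p].

Definition overlap (R : realType) (M : topologicalType) (n : nat)
    (c c' : chart R M n) : set 'rV[R]_n :=
  coord c @` (chart_dom c `&` chart_dom c').

Definition transition (R : realType) (M : topologicalType) (n : nat)
    (c c' : chart R M n) : 'rV[R]_n -> 'rV[R]_n := coord c' \o param c.

Record manifold (R : realType) (n : nat) := Manifold {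
  carrier :> topologicalType;
  atlas : set (chart R carrier n);
  manifold_hausdorff : hausdorff_space carrier;
  manifold_countable : @second_countable carrier;
  atlas_chart : forall c, atlas c -> is_chart c;
  atlas_cover : forall p : carrier, exists2 c, atlas c & chart_dom c p;
  atlas_smooth : forall c c', atlas c -> atlas c' ->
    smooth_on (overlap c c') (transition c c')
}.

(* Tensor fields on M are given by their local representatives.  In a chart c
   the tangent space at the point with coordinates x is 'rV[R]_n (the i-th unit
   vector being the i-th coordinate vector field); the representatives in two
   charts correspond to each other through the differential of the transition
   map.  Only the charts of the atlas and the points of chart_im c matter. *)
Definition vec_rep (R : realType) (n : nat) (M : manifold R n) : Type :=
  chart R M n -> 'rV[R]_n -> 'rV[R]_n.

Definition form_rep (R : realType) (n : nat) (M : manifold R n) (p : nat)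
    : Type :=
  chart R M n -> 'rV[R]_n -> ('I_p -> 'rV[R]_n) -> R.

Record vector_field (R : realType) (n : nat) (M : manifold R n) :=
  VectorField {
    vec_repr :> vec_rep M;
    vec_smooth : forall c, atlas c -> smooth_on (chart_im c) (vec_repr c);
    vec_compat : forall c c', atlas c -> atlas c' ->
      forall x, overlap c c' x ->
        vec_repr c' (transition c c' x) =
        'd (transition c c') x (vec_repr c x)
  }.

Definition alternating_multilinear (R : realType) (n p : nat)
    (f : ('I_p -> 'rV[R]_n) -> R) : Prop :=
  (forall (v : 'I_p -> 'rV[R]_n) (i : 'I_p) (a : R) (u w : 'rV[R]_n),
     f (dfwith v i (a *: u + w)) = a * f (dfwith v i u) + f (dfwith v i w)) /\
  (forall (v : 'I_p -> 'rV[R]_n) (i j : 'I_p),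
     i != j -> v i = v j -> f v = 0).

Record diff_form (R : realType) (n : nat) (M : manifold R n) (p : nat) :=
  DiffForm {
    form_repr :> form_rep M p;
    form_alternating : forall c, atlas c -> forall x, chart_im c x ->
      alternating_multilinear (form_repr c x);
    form_smooth : forall c, atlas c -> forall v : 'I_p -> 'rV[R]_n,
      smooth_on (chart_im c) (fun x => form_repr c x v : R^o);
    form_compat : forall c c', atlas c -> atlas c' ->
      forall x, overlap c c' x -> forall v : 'I_p -> 'rV[R]_n,
        form_repr c x v =
        form_repr c' (transition c c' x)
          (fun i => 'd (transition c c') x (v i))
  }.

(* The operations below act on local representatives by the usual coordinate
   formulas; they commute with changes of charts, so that applied to forms and
   vector fields on M they give forms and vector fields on M, and equality on M
   is equality of the representatives in every chart. *)
Section Operations.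
Variables (R : realType) (n : nat) (M : manifold R n).
Implicit Types X Y : vec_rep M.

Definition form_eq p (w t : form_rep M p) : Prop :=
  forall c, atlas c -> forall x, chart_im c x -> forall v, w c x v = t c x v.

Definition form_cst (a : R) : form_rep M 0 := fun _ _ _ => a.

Definition form_zero p : form_rep M p := fun _ _ _ => 0.

Definition nowhere_zero p (w : form_rep M p) : Prop :=
  forall c, atlas c -> forall x, chart_im c x -> exists v, w c x v != 0.

(* Normalised so that dx_1 /\ ... /\ dx_p takes the value 1 on
   (d/dx_1, ..., d/dx_p). *)
Definition form_wedge p q (w : form_rep M p) (t : form_rep M q)
    : form_rep M (p + q) :=
  fun c x v =>
    ((p`! * q`!)%N%:R)^-1 *
    \sum_(s : 'S_(p + q))
      (-1) ^+ s * w c x (fun i => v (s (lshift q i)))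
                * t c x (fun j => v (s (rshift p j))).

Fixpoint form_wedge_pow p (w : form_rep M p) (j : nat) : form_rep M (j * p) :=
  match j return form_rep M (j * p) with
  | 0 => form_cst 1
  | j'.+1 => form_wedge w (@form_wedge_pow p w j')
  end.

(* (dw)(v_0, ..., v_p) =
     sum_i (-1)^i D_{v_i} (w (v_0, ..., v_i omitted, ..., v_p))
   for constant vectors v_0, ..., v_p in a chart. *)
Definition ext_d p (w : form_rep M p) : form_rep M p.+1 :=
  fun c x v =>
    \sum_(i < p.+1)
      (-1) ^+ i *
      ('D_(v i) (fun y => w c y (fun j => v (lift i j)) : R^o) x : R).

(* X is inserted in the first slot; the interior product of a function is 0. *)
Definition interior_prod X p : form_rep M p -> form_rep M p.-1 :=
  match p with
  | 0 => fun _ _ _ _ => 0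
  | p'.+1 => fun w c x v =>
      w c x (fun i => if unlift ord0 i is Some j then v j else X c x)
  end.

Definition form_eval (a : form_rep M 1) X : form_rep M 0 :=
  fun c x _ => a c x (fun=> X c x).

Definition lie_bracket X Y : vec_rep M :=
  fun c x => 'D_(X c x) (Y c) x - 'D_(Y c x) (X c) x.

Definition vec_eq0 X : Prop :=
  forall c, atlas c -> forall x, chart_im c x -> X c x = 0.

End Operations.

Arguments form_cst {R n M} a.
Arguments form_zero {R n M p}.
Arguments form_wedge_pow {R n M p} w j.

Declare Scope form_scope.
Delimit Scope form_scope with F.
Notation "w ∧ t" := (form_wedge w t) (at level 60, right associativity)
  : form_scope.
Notation "w ^ j" := (form_wedge_pow w j) : form_scope.

Section ContactPair.
Variables (R : realType) (h k : nat) (M : manifold R (2 * h + 2 * k + 2)%N).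
Local Open Scope form_scope.

(* The degree of the last form below is equal to, though not convertible
   with, the dimension of M. *)
Definition contact_pair (alpha eta : diff_form M 1) : Prop :=
  [/\ form_eq (ext_d alpha ^ h.+1) form_zero,
      form_eq (ext_d eta ^ k.+1) form_zero &
      nowhere_zero
        (alpha ∧ (ext_d alpha ^ h) ∧ eta ∧ (ext_d eta ^ k))].

Definition reeb_fields (alpha eta : diff_form M 1) (Xa Xe : vector_field M)
    : Prop :=
  [/\ form_eq (form_eval alpha Xa) (form_cst 1),
      form_eq (interior_prod Xa ((ext_d alpha ^ h) ∧ eta ∧ (ext_d eta ^ k)))
        form_zero,
      form_eq (form_eval eta Xe) (form_cst 1) &
      form_eq (interior_prod Xe (alpha ∧ (ext_d alpha ^ h) ∧ (ext_d eta ^ k)))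
        form_zero].

End ContactPair.

Arguments contact_pair {R} h k {M} alpha eta.
Arguments reeb_fields {R} h k {M} alpha eta Xa Xe.

(* Main.v *)
Require Import Defs.
From mathcomp Require Import all_boot all_order all_algebra all_fingroup.
From mathcomp Require Import all_classical all_reals all_analysis.
From mathcomp Require Import ring lra zify.

(** The statement is local: it is checked in each chart of the atlas, where the
    forms take values on n-tuples of vectors, n = 2h + 2k + 2.

    At a point, write A = d alpha, E = d eta.  Since A^(h+1) = 0, while A^h <> 0
    as a factor of the volume form, the kernel of A has codimension at most 2h:
    if A^h takes a nonzero value on v_1, ..., v_2h and y is A-orthogonal to all
    the v_i, then
      0 = A^(h+1)(y, u, v) = (h+1) A(y, u) A^h(v)
    ([wedge_pow_insert2]), so that i_y A = 0; hence 2h linear equations imply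
    that y is in ker A ([two_form_kernel]).  Likewise ker E has codimension at
    most 2k.  Counting equations, there is Y <> 0 in ker A, ker E and ker eta
    ([kernel_vector]).  Contracting the volume form Om with Y gives
      i_Y Om = alpha(Y) (A^h /\ eta /\ E^k),
    hence i_X i_Y Om = 0 for every X in the kernel of the last form, in
    particular for X_alpha.  A volume form vanishes on (Y, X, ...) only if X is
    a multiple of Y ([top_form_colinear]), so X_alpha lies in ker A, ker E and
    ker eta ([reeb_alpha]).  The case of X_eta is the same with Y in ker alpha
    ([reeb_eta]).  These contractions rest on the antiderivation rule for
    interior products ([wedge_insert]).

    For the bracket Z of X_alpha and X_eta, differentiate the identities just
    obtained.  From d(d alpha) = 0 (the symmetry of second derivatives,
    [schwarz]) and the vanishing of the interior products of d alpha with both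
    Reeb fields, one gets i_Z d alpha = 0 ([bracket_kernel]); since
    alpha(X_alpha) and alpha(X_eta) are constant, also alpha(Z) = 0
    ([bracket_form]), and the same holds for eta.  A vector in the kernels of
    alpha, d alpha, eta and d eta is annihilated by the volume form, so Z = 0
    ([common_kernel_eq0]). *)

Set Implicit Arguments.
Unset Strict Implicit.
Unset Printing Implicit Defensive.

Import Order.TTheory GRing.Theory Num.Theory.
Import numFieldNormedType.Exports.

Local Open Scope classical_set_scope.
Local Open Scope ring_scope.

(** * Alternating forms on a vector space and their wedge product *)

Section Forms.
Variables (R : realType) (n : nat).
Local Notation V := 'rV[R]_n.
Local Notation mform p := (('I_p -> V) -> R).

Lemma dfwith_comm (I : eqType) (v : I -> V) i j a b : i != j ->
  dfwith (dfwith v i a) j b = dfwith (dfwith v j b) i a.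
Proof.
move=> ij; apply/funext => k; have [<-|jk] := eqVneq j k.
  by rewrite dfwithin dfwithout // dfwithin.
rewrite dfwithout //; have [<-|ik] := eqVneq i k; first by rewrite !dfwithin.
by rewrite !dfwithout.
Qed.

Lemma dfwith_id (I : eqType) (v : I -> V) i : dfwith v i (v i) = v.
Proof. by apply/funext => k; case: dfwithP. Qed.

Lemma alt_dfwithD p (f : mform p) v i a b : alternating_multilinear f ->
  f (dfwith v i (a + b)) = f (dfwith v i a) + f (dfwith v i b).
Proof. by case=> fl _; have := fl v i 1 a b; rewrite scale1r mul1r. Qed.

(** Polarisation: f vanishes when v_i + v_j is put in both slots i and j. *)
Lemma alt_tperm p (f : mform p) v (i j : 'I_p) : alternating_multilinear f ->
  i != j -> f (fun k => v (tperm i j k)) = - f v.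
Proof.
move=> fA ij; pose g a b := f (dfwith (dfwith v i a) j b).
have g0 a : g a a = 0.
  by apply: (fA.2 _ i j ij); rewrite dfwithin dfwithout 1?eq_sym // dfwithin.
have gDr a b c : g a (b + c) = g a b + g a c by exact: alt_dfwithD.
have gDl a b c : g (a + b) c = g a c + g b c.
  by rewrite /g !(dfwith_comm _ _ _ ij) alt_dfwithD.
have := g0 (v i + v j); rewrite gDl !gDr !g0 add0r addr0 => /eqP.
rewrite addrC addr_eq0 => /eqP gE.
have -> : f v = g (v i) (v j) by rewrite /g dfwith_id dfwith_id.
rewrite -gE /g; congr f; apply/funext => k.
case: tpermP => [->|->|/eqP ki /eqP kj]; last first.
- by rewrite !dfwithout // eq_sym.
- by rewrite dfwithin.
- by rewrite dfwithout 1?eq_sym // dfwithin.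
Qed.

Lemma alt_perm p (f : mform p) v (s : 'S_p) : alternating_multilinear f ->
  f (fun k => v (s k)) = (-1) ^+ s * f v.
Proof.
move=> fA; have [ts -> {s}] := prod_tpermP s.
elim: ts v => [|[i j] ts IH] v /=.
  rewrite big_nil odd_perm1 expr0 mul1r => _; congr f.
  by apply/funext => k; rewrite perm1.
rewrite big_cons => /andP[/= ij /IH {}IH].
set S := (\prod_(t <- ts) tperm t.1 t.2)%g in IH *.
have -> : (fun k => v ((tperm i j * S)%g k)) = (fun k => v (S (tperm i j k))).
  by apply/funext => k; rewrite permM.
rewrite (@alt_tperm _ _ (fun l => v (S l)) i j) // IH odd_permM odd_tperm ij.
by rewrite signr_addb expr1 mulN1r mulNr.
Qed.

(** The antisymmetrisation without a normalising factor, for an arbitrary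
    function of p vectors; it is kept apart from the wedge product because
    contractions are easiest to compute on it. *)
Definition altsum p (H : mform p) : mform p :=
  fun v => \sum_(s : 'S_p) (-1) ^+ s * H (fun i => v (s i)).

Definition tensor p q (w : mform p) (t : mform q) : mform (p + q) :=
  fun v => w (fun i => v (lshift q i)) * t (fun j => v (rshift p j)).

Definition wedge p q (w : mform p) (t : mform q) : mform (p + q) :=
  fun v => ((p`! * q`!)%N%:R)^-1 *
    \sum_(s : 'S_(p + q))
      (-1) ^+ s * w (fun i => v (s (lshift q i)))
                * t (fun j => v (s (rshift p j))).

Lemma wedgeE p q (w : mform p) (t : mform q) v :
  wedge w t v = ((p`! * q`!)%N%:R)^-1 * altsum (tensor w t) v.
Proof. by congr (_ * _); apply: eq_bigr => s _; rewrite mulrA. Qed.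

Definition multilinear p (f : mform p) :=
  forall (v : 'I_p -> V) (i : 'I_p) (a : R) (u w : V),
    f (dfwith v i (a *: u + w)) = a * f (dfwith v i u) + f (dfwith v i w).

(** Composing the summation index with the transposition of two slots that
    hold the same vector changes the sign of the sum but not its terms. *)
Lemma altsum_alternating p (H : mform p) : multilinear H ->
  alternating_multilinear (altsum H).
Proof.
move=> HL; split=> [v i a u w|v i j ij vij].
  rewrite /altsum big_distrr -big_split /=; apply: eq_bigr => s _.
  have E x : (fun k => dfwith v i x (s k)) =
      dfwith (fun k => v (s k)) ((s^-1)%g i) x.
    apply/funext => k; have [<-|ik] := eqVneq ((s^-1)%g i) k.
      by rewrite permKV !dfwithin.
    by rewrite !dfwithout //; apply: contra ik => /eqP ->; rewrite permK.
  by rewrite !E HL mulrDr mulrCA.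
set S := altsum H v; have : S = - S.
  rewrite {1}/S /altsum (reindex_inj (mulIg (tperm i j))) /= -sumrN.
  apply: eq_bigr => s _; rewrite odd_permM odd_tperm ij signr_addb expr1 mulrN1.
  rewrite mulNr; congr (- (_ * H _)); apply/funext => k; rewrite permM.
  by case: tpermP => // ->.
by move/eqP; rewrite -subr_eq0 opprK -mulr2n mulrn_eq0 => /eqP.
Qed.

Lemma tensor_multilinear p q (w : mform p) (t : mform q) :
  multilinear w -> multilinear t -> multilinear (tensor w t).
Proof.
move=> wL tL v i a x y; rewrite /tensor.
case: (splitP i) => [j ij|j ij].
  have -> : i = lshift q j by exact: val_inj.
  have El z : (fun k => dfwith v (lshift q j) z (lshift q k)) =
      dfwith (fun k => v (lshift q k)) j z.
    apply/funext => k; have [<-|jk] := eqVneq j k; first by rewrite !dfwithin.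
    by rewrite !dfwithout // eq_lshift.
  have Er z : (fun k => dfwith v (lshift q j) z (rshift p k)) =
      (fun k => v (rshift p k)).
    by apply/funext => k; rewrite dfwithout // eq_lrshift.
  by rewrite !El !Er wL; ring.
have -> : i = rshift p j by exact: val_inj.
have El z : (fun k => dfwith v (rshift p j) z (rshift p k)) =
    dfwith (fun k => v (rshift p k)) j z.
  apply/funext => k; have [<-|jk] := eqVneq j k; first by rewrite !dfwithin.
  by rewrite !dfwithout // eq_rshift.
have Er z : (fun k => dfwith v (rshift p j) z (lshift q k)) =
    (fun k => v (lshift q k)).
  by apply/funext => k; rewrite dfwithout // eq_rlshift.
by rewrite !El !Er tL; ring.
Qed.

Lemma altZ p (f : mform p) c : alternating_multilinear f ->
  alternating_multilinear (fun v => c * f v).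
Proof.
case=> fL fA; split=> [v i a u w|v i j ij vij]; first by rewrite fL; ring.
by rewrite (fA v i j) ?mulr0.
Qed.

Lemma wedge_alternating p q (w : mform p) (t : mform q) :
  alternating_multilinear w -> alternating_multilinear t ->
  alternating_multilinear (wedge w t).
Proof.
move=> [wL _] [tL _].
rewrite (_ : wedge w t =
  fun v => ((p`! * q`!)%N%:R)^-1 * altsum (tensor w t) v).
  exact/altZ/altsum_alternating/tensor_multilinear.
by apply/funext => v; exact: wedgeE.
Qed.

Lemma altsum_alt p (f : mform p) v : alternating_multilinear f ->
  altsum f v = (p`!)%:R * f v.
Proof.
move=> fA; rewrite /altsum.
under eq_bigr do rewrite alt_perm // mulrA -signr_addb addbb mul1r.
by rewrite sumr_const card_Sn mulr_natl.
Qed.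

(** * Interior products *)

(** The arguments of forms are also given by sequences indexed by nat, of which
    only the first p terms matter for a p-form.  Degrees such as p + q.+1 and
    (p + q).+1, which are equal but not convertible, then need no casts. *)
Definition insert a (y : V) (u : nat -> V) k :=
  if (k < a)%N then u k else if k == a then y else u k.-1.

Definition extend p (v : 'I_p -> V) k : V :=
  if insub k is Some i then v i else 0.

Lemma extend_ord p (v : 'I_p -> V) (i : 'I_p) : extend v i = v i.
Proof. by rewrite /extend valK. Qed.

Lemma extendK p (v : 'I_p -> V) : (fun i : 'I_p => extend v i) = v.
Proof. by apply/funext => i; exact: extend_ord. Qed.

Lemma extend_seq p (u : nat -> V) k : (k < p)%N ->
  extend (fun i : 'I_p => u i) k = u k.
Proof. by move=> kp; rewrite /extend insubT. Qed.

Lemma altsum_cast p q (H : mform p) (H' : mform q) :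
  p = q -> (forall u : nat -> V, H (fun i => u i) = H' (fun i => u i)) ->
  forall u : nat -> V, altsum H (fun i => u i) = altsum H' (fun i => u i).
Proof.
move=> e; subst q => E u; congr altsum; apply/funext => v.
by rewrite -(extendK v) E.
Qed.

Lemma insert_lift p (a : 'I_p.+1) y u (j : 'I_p) :
  insert a y u (lift a j) = u j.
Proof.
rewrite /insert /= /bump.
case: (leqP a j) => [aj|ja]; last by rewrite add0n ?ja.
by rewrite add1n ifF ?ifF //; lia.
Qed.

Lemma insert_id a y u : insert a y u a = y.
Proof. by rewrite /insert ltnn eqxx. Qed.

Lemma insert_lift_perm p (a : 'I_p.+1) y u (s : 'S_p) (k : 'I_p.+1) :
  insert 0 y u (lift_perm a ord0 s k) =
  insert a y (extend (fun i => u (s i))) k.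
Proof.
case: (unliftP a k) => [j ->|->]; last by rewrite lift_perm_id !insert_id.
by rewrite lift_perm_lift insert_lift extend_ord (insert_lift ord0).
Qed.

Lemma alt_insert p (f : mform p) (a : 'I_p) y u : alternating_multilinear f ->
  f (fun k => insert a y u k) = (-1) ^+ a * f (fun k => insert 0 y u k).
Proof.
case: p f a => [f [] //|p f a fA].
have -> : (-1) ^+ a = (-1) ^+ lift_perm a ord0 1 :> R.
  by rewrite odd_lift_perm odd_perm1 addbF addbF signr_odd.
rewrite -alt_perm //; congr f; apply/funext => k.
rewrite insert_lift_perm.
case: (unliftP a k) => [j ->|->]; last by rewrite !insert_id.
by rewrite !insert_lift extend_ord perm1.
Qed.

(** Expansion along the first argument y: the permutations of q.+1 slots are
    sorted by the slot i that receives y, and those sending i to 0 are the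
    [lift_perm i ord0 s], of sign (-1)^i times that of s. *)
Lemma altsum_contract p q (H : mform p) y u : p = q.+1 ->
  altsum H (fun i => insert 0 y u i) =
  \sum_(i < p) (-1) ^+ i *
    altsum (fun v : 'I_q -> V => H (fun k => insert i y (extend v) k))
      (fun i => u i).
Proof.
move=> e; subst p.
rewrite /altsum (partition_big (fun s : 'S_q.+1 => (s^-1)%g ord0) xpredT) //=.
apply: eq_bigr => i _; rewrite (reindex (lift_perm i ord0)) /=; last first.
  (* [ulsf] reads s back off the permutation [lift_perm i ord0 s]. *)
  pose ulsf i (s : 'S_q.+1) k := odflt k (unlift (s i) (s (lift i k))).
  have ulsfK i' (s : 'S_q.+1) k : lift (s i') (ulsf i' s k) = s (lift i' k).
    rewrite /ulsf; have:= neq_lift i' k.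
    by rewrite -(can_eq (permK s)) => /unlift_some[] ? ? ->.
  have inj_ulsf : injective (ulsf i _).
    move=> s; apply: can_inj (ulsf (s i) s^-1%g) _ => k'.
    by rewrite {1}/ulsf ulsfK !permK liftK.
  exists (fun s => perm (inj_ulsf s)) => [s _ | s].
    by apply/permP=> k'; rewrite permE /ulsf lift_perm_lift lift_perm_id liftK.
  rewrite inE /= => /eqP si; have si0 : s i = ord0 by rewrite -si permKV.
  apply/permP=> k.
  case: (unliftP i k) => [k'|] ->; rewrite ?lift_perm_id //.
  by rewrite lift_perm_lift -si0 permE ulsfK.
rewrite big_distrr /=; apply: eq_big => [s|s _].
  by rewrite lift_permV lift_perm_id eqxx.
rewrite odd_lift_perm addbF signr_addb signr_odd mulrA; congr (_ * H _).
by apply/funext => k; rewrite insert_lift_perm.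
Qed.

(** The truncated degree p.-1 and the form of the body make it convertible with
    [interior_prod] at a point of a chart. *)
Definition iprod (y : V) p : mform p -> mform p.-1 :=
  match p with
  | 0 => fun _ _ => 0
  | p'.+1 => fun w v =>
      w (fun i => if unlift ord0 i is Some j then v j else y)
  end.

Lemma iprodE y p (f : mform p.+1) (u : nat -> V) :
  iprod y f (fun i : 'I_p => u i) = f (fun i => insert 0 y u i).
Proof.
congr f; apply/funext => i.
case: unliftP => [j ->|->]; last by rewrite insert_id.
by rewrite (insert_lift ord0).
Qed.

Lemma iprod_insert y p (f : mform p) (a : 'I_p) (u : nat -> V) :
  alternating_multilinear f ->
  f (fun i => insert a y u i) = (-1) ^+ a * iprod y f (fun i => u i).
Proof. by case: p f a => [f [] //|p f a fA]; rewrite alt_insert // iprodE. Qed.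

Lemma insert_extend p a y (u : nat -> V) k : (a <= p)%N -> (k <= p)%N ->
  insert a y (extend (fun i : 'I_p => u i)) k = insert a y u k.
Proof.
move=> ap kp; rewrite /insert; case: ltngtP => // h; rewrite extend_seq //; lia.
Qed.

Lemma altsumZ p (H : mform p) c v :
  altsum (fun v => c * H v) v = c * altsum H v.
Proof.
by rewrite /altsum big_distrr /=; apply: eq_bigr => s _; rewrite mulrCA.
Qed.

(** The antiderivation rule i_y (w /\ t) = i_y w /\ t + (-1)^p w /\ i_y t.  In
    the expansion along y, the p slots of w contribute equally since w is
    alternating, and so do the q slots of t; the factors p and q turn p! and q!
    into (p-1)! and (q-1)!. *)
Lemma wedge_insert p q (w : mform p) (t : mform q) y u :
  alternating_multilinear w -> alternating_multilinear t -> (0 < p + q)%N ->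
  wedge w t (fun i => insert 0 y u i) =
  wedge (iprod y w) t (fun i => u i) +
  (-1) ^+ p * wedge w (iprod y t) (fun i => u i).
Proof.
move=> wA tA pq; rewrite wedgeE (@altsum_contract _ (p + q).-1); last by lia.
rewrite big_split_ord mulrDr /=; congr (_ + _).
  under eq_bigr => a _.
    rewrite (@altsum_cast _ (p.-1 + q) _
      (fun v => (-1) ^+ a * tensor (iprod y w) t v)).
  - rewrite altsumZ mulrA -expr2 sqrr_sign mul1r; over.
  - by have := ltn_ord a; lia.
  - move=> u'; rewrite /tensor mulrA -iprod_insert //; congr (w _ * t _).
      by apply/funext => k; rewrite insert_extend //=;
        have := ltn_ord a; have := ltn_ord k; lia.
    apply/funext => k; rewrite insert_extend /=;
      do ?[have := ltn_ord a; have := ltn_ord k; lia].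
    rewrite /insert; have -> : (p + k < a)%N = false by have := ltn_ord a; lia.
    have -> : (p + k == a)%N = false by have := ltn_ord a; lia.
    by congr u'; have := ltn_ord a; lia.
  rewrite sumr_const card_ord wedgeE; case: p w wA pq => [|p] w wA pq /=.
    rewrite mulr0n mulr0 /altsum big1 ?mulr0 // => s _.
    by rewrite /tensor mul0r mulr0.
  by rewrite factS !natrM -[_ *+ p.+1]mulr_natl; field;
    rewrite nat1r !pnatr_eq0 -!lt0n !fact_gt0.
under eq_bigr => a _.
  rewrite (@altsum_cast _ (p + q.-1) _
      (fun v => (-1) ^+ a * tensor w (iprod y t) v)).
- rewrite altsumZ exprD mulrA -(mulrA (_ ^+ p)) -expr2 sqrr_sign mulr1; over.
- by have := ltn_ord a; lia.
- move=> u'; rewrite /tensor mulrCA.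
  rewrite -(@iprod_insert y q t a (fun j => u' (p + j)%N)) //.
  congr (w _ * t _).
    apply/funext => k; rewrite insert_extend /=;
      do ?[have := ltn_ord a; have := ltn_ord k; lia].
    by rewrite /insert ifT //; have := ltn_ord a; have := ltn_ord k; lia.
  apply/funext => k; rewrite insert_extend /=;
      do ?[have := ltn_ord a; have := ltn_ord k; lia].
  rewrite /insert ltn_add2l eqn_add2l; case: ltngtP => // ak.
  by congr u'; lia.
rewrite sumr_const card_ord wedgeE; case: q t tA pq => [|q] t tA pq /=.
  rewrite mulr0n mulr0 /altsum big1 ?mulr0 // => s _.
  by rewrite /tensor !mulr0.
by rewrite factS !natrM -[_ *+ q.+1]mulr_natl; field;
    rewrite nat1r !pnatr_eq0 -!lt0n !fact_gt0.
Qed.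

Lemma iprod_alternating y p (f : mform p) : alternating_multilinear f ->
  alternating_multilinear (iprod y f).
Proof.
case: p f => [|p] f [fL fA]; first by split=> [v []|v []].
split=> [v i a u w|v i j ij vij] /=.
  have E x : (fun k : 'I_p.+1 =>
        if unlift ord0 k is Some j then dfwith v i x j else y)
      = dfwith
          (fun k : 'I_p.+1 => if unlift ord0 k is Some j then v j else y)
          (lift ord0 i) x.
    apply/funext => k; case: (unliftP ord0 k) => [j ->|->].
      have [<-|ij] := eqVneq i j; first by rewrite !dfwithin.
      by rewrite !dfwithout ?liftK // (inj_eq lift_inj).
    by rewrite dfwithout ?unlift_none // eq_sym neq_lift.
  by rewrite !E fL.
apply: (fA _ (lift ord0 i) (lift ord0 j));
  by rewrite ?(inj_eq lift_inj) // !liftK.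
Qed.

Lemma iprodE_gt0 y p (f : mform p) (u : nat -> V) : (0 < p)%N ->
  iprod y f (fun i : 'I_p.-1 => u i) = f (fun i => insert 0 y u i).
Proof. by case: p f => // p f _; exact: iprodE. Qed.

Lemma wedge_vanishl p q (w : mform p) (t : mform q) v :
  (forall s : 'S_(p + q), w (fun i => v (s (lshift q i))) = 0) ->
  wedge w t v = 0.
Proof.
move=> H; by rewrite /wedge big1 ?mulr0 // => s _; rewrite H mulr0 mul0r.
Qed.

Lemma wedge_vanishr p q (w : mform p) (t : mform q) v :
  (forall s : 'S_(p + q), t (fun i => v (s (rshift p i))) = 0) ->
  wedge w t v = 0.
Proof. by move=> H; rewrite /wedge big1 ?mulr0 // => s _; rewrite H mulr0. Qed.

Lemma eq_wedger p q (w : mform p) (t t' : mform q) v :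
  (forall s : 'S_(p + q),
     t (fun i => v (s (rshift p i))) = t' (fun i => v (s (rshift p i)))) ->
  wedge w t v = wedge w t' v.
Proof. by move=> H; congr (_ * _); apply: eq_bigr => s _; rewrite H. Qed.

Lemma wedgeZr p q (w : mform p) (t : mform q) c v :
  wedge w (fun x => c * t x) v = c * wedge w t v.
Proof.
rewrite /wedge mulrCA; congr (_ * _); rewrite big_distrr /=.
by apply: eq_bigr => s _; rewrite mulrCA.
Qed.

Lemma wedge_castr p q q' (w : mform p) (t : mform q) (t' : mform q') : q = q' ->
  (forall u : nat -> V, t (fun i => u i) = t' (fun i => u i)) ->
  forall u : nat -> V, wedge w t (fun i => u i) = wedge w t' (fun i => u i).
Proof.
move=> e E u; subst q'; congr wedge; apply/funext => v.
by rewrite -(extendK v) E.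
Qed.

Lemma wedge0 q (c : mform 0) (t : mform q) v : alternating_multilinear t ->
  wedge c t v = c (fun i => v (lshift q i)) * t v.
Proof.
move=> tA; rewrite wedgeE.
rewrite (_ : tensor c t = fun x => c (fun i => v (lshift q i)) * t x).
  by rewrite altsumZ altsum_alt // mul1n; field;
    rewrite pnatr_eq0 -lt0n fact_gt0.
apply/funext => x; rewrite /tensor; congr (c _ * t _).
  by apply/funext => - [].
by apply/funext => i; congr x; exact: val_inj.
Qed.

Lemma wedge1_insert q (a : mform 1) (t : mform q) y u :
  alternating_multilinear a -> alternating_multilinear t ->
  wedge a t (fun i => insert 0 y u i) =
  a (fun=> y) * t (fun i => u i) - wedge a (iprod y t) (fun i => u i).
Proof.
move=> aA tA; rewrite wedge_insert // expr1 mulN1r wedge0 //.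
congr (a _ * t _ - _).
by apply/funext => i; case: unliftP => [[]|].
Qed.

(** For an alternating form this says that y lies in its kernel; asking it for
    all slots makes it stable under wedge products of arbitrary functions. *)
Definition kills p (y : V) (f : mform p) := forall v i, v i = y -> f v = 0.

Lemma kills_wedge p q y (w : mform p) (t : mform q) :
  kills y w -> kills y t -> kills y (wedge w t).
Proof.
move=> kw kt v i vi; rewrite /wedge big1 ?mulr0 // => s _.
have [j|j] := splitP ((s^-1)%g i) => Ej.
  rewrite (kw _ j) ?mulr0 ?mul0r // -vi; congr v.
  by rewrite -[RHS](permKV s); congr (s _); exact: val_inj.
rewrite (kt _ j) ?mulr0 // -vi; congr v.
by rewrite -[RHS](permKV s); congr (s _); exact: val_inj.
Qed.

Fixpoint wedge_pow p (w : mform p) (j : nat) : mform (j * p) :=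
  match j return mform (j * p) with
  | 0 => fun=> 1
  | j'.+1 => wedge w (@wedge_pow p w j')
  end.

Arguments wedge_pow {p} w j.

Lemma wedge_pow_alternating p (w : mform p) j : alternating_multilinear w ->
  alternating_multilinear (wedge_pow w j).
Proof.
move=> wA; elim: j => [|j IH] /=; last exact: wedge_alternating.
by split=> [v []|v []].
Qed.

Lemma kills_wedge_pow p y (w : mform p) j :
  kills y w -> kills y (wedge_pow w j).
Proof. by move=> kw; elim: j => [v []|j IH] //=; exact: kills_wedge. Qed.

Lemma kills_iprod p y (f : mform p) : kills y f -> iprod y f = fun=> 0.
Proof.
case: p f => [//|p] f kf; apply/funext => v /=.
by apply: (kf _ ord0); rewrite unlift_none.
Qed.

Lemma alt_dfwith0 p (f : mform p) v i : alternating_multilinear f ->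
  f (dfwith v i 0) = 0.
Proof.
move=> fA; have /eqP := alt_dfwithD v i 0 0 fA.
by rewrite addr0 -subr_eq0 opprD addNKr oppr_eq0 => /eqP.
Qed.

Lemma kills_scale p y c (f : mform p) : alternating_multilinear f ->
  kills y f -> kills (c *: y) f.
Proof.
move=> fA kf v i vi; rewrite -(dfwith_id v i) vi -[c *: y]addr0 fA.1.
by rewrite alt_dfwith0 // (kf _ i) ?dfwithin // mulr0 addr0.
Qed.

Lemma kills_first p y (f : mform p) : alternating_multilinear f ->
  (forall u, f (fun i => insert 0 y u i) = 0) -> kills y f.
Proof.
move=> fA H v i vi.
rewrite (_ : v = fun k : 'I_p => insert i y (fun j => extend v (bump i j)) k).
  by rewrite alt_insert // H mulr0.
case: p f fA H v i vi => [f _ _ v []//|p f fA H v i vi].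
apply/funext => k; case: (unliftP i k) => [j ->|->]; last by rewrite insert_id.
by rewrite insert_lift -(extend_ord v).
Qed.

(** * Powers of a 2-form *)

Definition bil (A : mform 2) y u := iprod y A (fun=> u).

Lemma bilE (A : mform 2) v : A v = bil A (v ord0) (v (lift ord0 ord0)).
Proof.
rewrite /bil /=; congr A; apply/funext => i.
by case: (unliftP ord0 i) => [j ->|->]//; rewrite (ord1 j).
Qed.

Lemma iprod_bil (A : mform 2) y v : iprod y A v = bil A y (v ord0).
Proof. by congr iprod; apply/funext => i; rewrite (ord1 i). Qed.

Lemma bilC (A : mform 2) y u : alternating_multilinear A ->
  bil A y u = - bil A u y.
Proof.
move=> AA; pose i1 : 'I_2 := lift ord0 ord0.
pose v (i : 'I_2) := if i == ord0 then u else y.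
have -> : bil A u y = A v by rewrite bilE.
by rewrite -(alt_tperm v (i := ord0) (j := i1) AA) // bilE /v tpermL tpermR.
Qed.

Lemma bil_kills (A : mform 2) y : alternating_multilinear A ->
  (forall u, bil A y u = 0) -> kills y A.
Proof.
move=> AA H v i vi; rewrite bilE; case: (unliftP ord0 i) => [j|] Ei.
  by rewrite bilC // -vi {}Ei (ord1 j) in H *; rewrite H oppr0.
by rewrite -Ei vi H.
Qed.

(** In each term of the antisymmetrised product, y is paired by A with one of
    the other arguments. *)
Lemma wedge_pow_orth (A : mform 2) y j (x : 'I_(j * 2) -> V) i0 :
  alternating_multilinear A -> (forall i, bil A y (x i) = 0) -> x i0 = y ->
  wedge_pow A j x = 0.
Proof.
move=> AA; elim: j x i0 => [x []//|j IH] x i0 Hx xi0.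
rewrite /= /wedge big1 ?mulr0 // => s _.
have [a|a] := splitP ((s^-1)%g i0) => Ea.
  rewrite (_ : A _ = 0) ?mulr0 ?mul0r //.
  have xa : x (s (lshift (j * 2) a)) = y.
    rewrite -xi0; congr x; rewrite -[RHS](permKV s); congr (s _).
    exact: val_inj.
  rewrite bilE; case: (unliftP ord0 a) => [b|] Eb.
    by move: xa; rewrite Eb (ord1 b) => ->; rewrite bilC // Hx oppr0.
  by rewrite -Eb xa Hx.
rewrite (IH _ a) ?mulr0 //=.
by rewrite -xi0; congr x; rewrite -[RHS](permKV s); congr (s _); exact: val_inj.
Qed.

Lemma bil0 (A : mform 2) y : alternating_multilinear A -> bil A y 0 = 0.
Proof.
move=> AA; have IA := iprod_alternating y AA.
by have := alt_dfwith0 (fun=> 0) ord0 IA; rewrite iprod_bil dfwithin.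
Qed.

(** If y is A-orthogonal to the v_i, contracting A^(j+1) with y and u leaves
    only the terms in which A pairs y with u.  By the antiderivation rule
    applied twice to A /\ A^j, the first factor contributes A(y, u) A^j, the
    mixed terms vanish on v, and the second factor contributes
    A /\ i_u i_y A^j, which is j times the same by induction. *)
Lemma wedge_pow_insert2 (A : mform 2) j y u (v : nat -> V) :
  alternating_multilinear A -> (forall i, bil A y (v i) = 0) ->
  wedge_pow A j.+1 (fun i => insert 0 y (insert 0 u v) i) =
  j.+1%:R * bil A y u * wedge_pow A j (fun i => v i).
Proof.
move=> AA; elim: j u v => [|j IH] u v Hv.
(* Both cases of the induction start with the same two contractions. *)
all: set m := (X in wedge_pow A X.+1); have PA := wedge_pow_alternating m AA.
all: have IPA := iprod_alternating y PA.
all: have IA : @alternating_multilinear R n 1 (iprod y A)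
  by exact: (iprod_alternating y AA).
all: rewrite [LHS](wedge_insert _ _ AA PA) // (wedge1_insert u v IA PA).
all: rewrite (@wedge_vanishl 1 _ (iprod y A)) ?subr0 => [|s];
  last by rewrite iprod_bil Hv.
all: rewrite sqrrN expr1n mul1r.
all: rewrite (wedge_insert _ _ AA IPA) //.
  by rewrite !wedge_vanishr // mulr0 !addr0 mul1r.
(* Here iprod y (A^(j+1)) is applied to some of the v_i, all orthogonal to y. *)
rewrite (@wedge_vanishr _ _ (iprod u A)) ?add0r => [|s]; last first.
  rewrite /iprod.
  apply: (@wedge_pow_orth A y j.+1 _ (@ord0 (j * 2).+1)) => // [i|].
    case: unliftP => [k _|_]; first exact: Hv.
    by have /eqP := bilC y y AA; rewrite -addr_eq0 -mulr2n mulrn_eq0 => /eqP.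
  by rewrite unlift_none.
rewrite sqrrN expr1n mul1r.
rewrite (@eq_wedger _ _ _ _
  (fun x => j.+1%:R * bil A y u * wedge_pow A j x)) => [|s].
  rewrite (wedgeZr _ (wedge_pow A j)) iprod_bil.
  rewrite -[wedge A (wedge_pow A j)]/(wedge_pow A m).
  by rewrite -[j.+2%:R]nat1r !mulrDl mul1r.
set x := (fun i => v _).
rewrite -(extendK x) iprodE iprodE IH // => i.
rewrite /extend; case: insubP => [k _ _|_]; last exact: bil0.
exact: Hv.
Qed.

End Forms.

Arguments wedge_pow {R n p} w j _.

(** * Kernels of forms, and the linear algebra of a contact pair *)

Section Kernels.
Variables (R : realType) (n : nat).
Local Notation V := 'rV[R]_n.
Local Notation mform p := (('I_p -> V) -> R).

Lemma alt_dfwith_sum p (f : mform p) v i (I : finType)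
    (c : I -> R) (w : I -> V) :
  alternating_multilinear f ->
  f (dfwith v i (\sum_j c j *: w j)) = \sum_j c j * f (dfwith v i (w j)).
Proof.
move=> fA.
rewrite (big_morph (fun x => f (dfwith v i x)) (id1 := 0) (op1 := +%R)).
- apply: eq_bigr => j _.
  by rewrite -[c j *: w j]addr0 fA.1 alt_dfwith0 // addr0.
- by move=> x y; exact: alt_dfwithD.
- exact: alt_dfwith0.
Qed.

(** If f(v) <> 0, the v_j are independent modulo the kernel of f: in a relation
    modulo the kernel, putting the combination of the v_i in slot j gives the
    j-th coefficient times f(v), as the other terms repeat an argument. *)
Lemma alt_kernel_bound p m (f : mform p) v (K : 'M[R]_(m, n)) :
  alternating_multilinear f -> f v != 0 -> (forall i, kills (row i K) f) ->
  row_free K -> (m + p <= n)%N.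
Proof.
move=> fA fv Kf K_free; pose W := \matrix_(j < p) v j.
suff: row_free (col_mx K W) by move/eqP <-; exact: rank_leq_col.
rewrite -kermx_eq0; apply/rowV0P => c /sub_kermxP.
rewrite -[c]hsubmxK mul_row_col; move: (lsubmx c) (rsubmx c) => a b E.
have b0 : b = 0.
  apply/rowP => j; rewrite mxE; apply/eqP.
  suff: b 0 j * f v == 0 by rewrite mulf_eq0 (negbTE fv) orbF.
  have <- : f (dfwith v j (\sum_i b 0 i *: v i)) = b 0 j * f v.
    rewrite alt_dfwith_sum // (bigD1 j) //= dfwith_id big1 ?addr0 // => i ij.
    by rewrite (fA.2 _ i j ij) ?mulr0 // dfwithin dfwithout // eq_sym.
  have -> : \sum_i b 0 i *: v i = \sum_i (- a 0 i) *: row i K.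
    have <- : b *m W = \sum_i b 0 i *: v i.
      by rewrite mulmx_sum_row; apply: eq_bigr => i _; rewrite rowK.
    under eq_bigr do rewrite scaleNr.
    by rewrite sumrN -mulmx_sum_row; apply/eqP; rewrite -addr_eq0 addrC E.
  rewrite alt_dfwith_sum // big1 // => i _.
  by rewrite (Kf i _ j) ?mulr0 // dfwithin.
move: E; rewrite b0 mul0mx addr0 => aK.
have -> : a = 0 by apply: (row_free_inj K_free); rewrite aK mul0mx.
by rewrite row_mx0.
Qed.

Lemma top_form_nondegenerate p (f : mform p) v Y : p = n ->
  alternating_multilinear f -> f v != 0 -> kills Y f -> Y = 0.
Proof.
move=> pn fA fv kY; apply/eqP; case: (eqVneq Y 0) => // Y0.
suff: (1 + p <= n)%N by rewrite pn ltnn.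
apply: (alt_kernel_bound fA fv (K := Y)) => [i|].
  by rewrite (_ : row i Y = Y) //; apply/rowP => j; rewrite mxE (ord1 i).
by rewrite /row_free rank_rV Y0.
Qed.

(** The form i_Y f is nonzero of degree n - 1, so that its kernel, which
    contains Y and X, has dimension at most 1. *)
Lemma top_form_colinear p (f : mform p) v X Y : p = n ->
  alternating_multilinear f -> f v != 0 -> Y != 0 ->
  (forall u, f (fun i => insert 0 Y (insert 0 X u) i) = 0) ->
  exists c, X = c *: Y.
Proof.
move=> pn fA fv Y0 fYX.
case: p f v pn fA fv fYX => [|p] f v pn fA fv fYX.
  by case/negP: Y0; apply/eqP/rowP => j; case: (cast_ord (esym pn) j).
have [w fw] : exists w, iprod Y f w != 0.
  apply: contrapT => /forallNP H; case/negP: Y0; apply/eqP.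
  apply: (top_form_nondegenerate pn fA fv); apply: kills_first => // u.
  by rewrite -iprodE; apply/eqP; apply/negPn/negP; exact: H.
have IA : @alternating_multilinear R n p (iprod Y f)
  by exact: (iprod_alternating Y fA).
apply: contrapT => /forallNP XY.
suff: (1 + 1 + p <= n)%N by rewrite -pn ltnn.
apply: (alt_kernel_bound (K := col_mx Y X) IA fw) => [i|].
  case: (splitP i) => j ij.
    have -> : row i (col_mx Y X) = Y.
      by rewrite (_ : i = lshift 1 j) ?rowKu ?row_id //; exact: val_inj.
    move=> x l xl /=.
    by apply: (fA.2 _ ord0 (lift ord0 l)); rewrite ?unlift_none ?liftK.
  have -> : row i (col_mx Y X) = X.
    by rewrite (_ : i = rshift 1 j) ?rowKd ?row_id //; exact: val_inj.
  by apply: kills_first => // u; rewrite iprodE.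
rewrite -kermx_eq0; apply/rowV0P => c /sub_kermxP.
rewrite -[c]hsubmxK mul_row_col; move: (lsubmx c) (rsubmx c) => a b.
rewrite [a]mx11_scalar [b]mx11_scalar !mul_scalar_mx => E.
have b0 : b 0 0 = 0.
  apply: contrapT => /eqP b0; apply: (XY (- (a 0 0) / b 0 0)).
  apply: (scalerI b0); rewrite scalerA mulrC divfK // scaleNr.
  by apply/eqP; rewrite -addr_eq0 addrC E.
move: E; rewrite b0 scale0r addr0 => /eqP; rewrite scaler_eq0 (negbTE Y0) orbF.
by move/eqP ->; rewrite raddf0 row_mx0.
Qed.

(** This bounds the rank of A by 2h; the equations are A(y, v_j) = 0 for some
    v_1, ..., v_2h with A^h(v) <> 0. *)
Lemma two_form_kernel (A : mform 2) h : alternating_multilinear A ->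
  (forall v, wedge_pow A h.+1 v = 0) -> (exists v, wedge_pow A h v != 0) ->
  exists C : 'M[R]_(n, h * 2), forall y : V, y *m C = 0 -> kills y A.
Proof.
move=> AA Ah1 [v Ahv].
exists (\matrix_(i, j) bil A (delta_mx 0 i) (v j)) => y yC.
have yv j : bil A y (v j) = 0.
  transitivity ((y *m \matrix_(i, j) bil A (delta_mx 0 i) (v j)) 0 j).
    rewrite mxE {1}(row_sum_delta y).
    have e x : bil A x (v j) = - A (dfwith (fun=> v j) (lift ord0 ord0) x).
      by rewrite bilC // bilE dfwithin dfwithout.
    rewrite e alt_dfwith_sum // -sumrN; apply: eq_bigr => i _.
    by rewrite mxE e mulrN.
  by rewrite yC mxE.
apply: bil_kills => // u; apply/eqP.
(* [extend] completes the v_j by 0, which is A-orthogonal to y as well. *)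
have yv' k : bil A y (extend v k) = 0.
  by rewrite /extend; case: insubP => [j _ _|_]; [exact: yv|exact: bil0].
have := wedge_pow_insert2 h u AA yv'; rewrite Ah1 extendK => /esym/eqP.
by rewrite !mulf_eq0 (negbTE Ahv) pnatr_eq0 /= orbF.
Qed.

Lemma wedge_neq0 p q (w : mform p) (t : mform q) v : wedge w t v != 0 ->
  (exists x, w x != 0) /\ (exists x, t x != 0).
Proof.
move=> wt; split; apply: contrapT => /forallNP H; case/negP: wt; apply/eqP.
  by apply: wedge_vanishl => s; apply/eqP/negPn/negP; exact: H.
by apply: wedge_vanishr => s; apply/eqP/negPn/negP; exact: H.
Qed.

Section Contact.
Variables (h k : nat) (a e : mform 1) (A E : mform 2).
Hypothesis (nE : n = (2 * h + 2 * k + 2)%N).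
Hypotheses (aA : alternating_multilinear a) (eA : alternating_multilinear e).
Hypotheses (AA : alternating_multilinear A) (EA : alternating_multilinear E).
Hypotheses (Ah : forall v, wedge_pow A h.+1 v = 0)
  (Ek : forall v, wedge_pow E k.+1 v = 0).
Let T := wedge (wedge_pow A h) (wedge e (wedge_pow E k)).
Let Om := wedge a T.
Hypothesis (Om_neq0 : exists v, Om v != 0).

Let AhA := wedge_pow_alternating h AA.
Let EkA := wedge_pow_alternating k EA.
Let eEA := wedge_alternating eA EkA.
Let TA : alternating_multilinear T := wedge_alternating AhA eEA.
Let OmA : alternating_multilinear Om := wedge_alternating aA TA.

Let deg : (1 + (h * 2 + (1 + k * 2)) = n)%N.
Proof. by rewrite nE; lia. Qed.

Lemma common_kernel_eq0 Z :
  kills Z a -> kills Z A -> kills Z e -> kills Z E -> Z = 0.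
Proof.
move=> Za ZA Ze ZE; have [v Omv] := Om_neq0.
apply: (top_form_nondegenerate deg OmA Omv).
by apply: kills_wedge => //; apply: kills_wedge; [|apply: kills_wedge] => //;
  apply: kills_wedge_pow.
Qed.

(** There are 2h + 2k + 1 linear equations in 2h + 2k + 2 unknowns. *)
Lemma kernel_vector (b : mform 1) : alternating_multilinear b ->
  exists Y, [/\ Y != 0, kills Y A, kills Y E & kills Y b].
Proof.
move=> bA; have [v Omv] := Om_neq0.
have [_ [v1 /wedge_neq0[A0 [v2 /wedge_neq0[_ E0]]]]] := wedge_neq0 Omv.
have [CA HCA] := two_form_kernel AA Ah A0.
have [CE HCE] := two_form_kernel EA Ek E0.
pose Cb : 'cV[R]_n := \col_i b (fun=> delta_mx 0 i).
pose C := row_mx (row_mx CA CE) Cb.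
have : kermx C != 0.
  rewrite -mxrank_eq0 mxrank_ker -lt0n subn_gt0.
  by apply: leq_ltn_trans (rank_leq_col _) _; move: nE; lia.
case/rowV0Pn => Y /sub_kermxP; rewrite !mul_mx_row => /eqP.
rewrite !row_mx_eq0 => /andP[/andP[/eqP YA /eqP YE] /eqP Yb] Y0.
exists Y; split; [by []|exact: HCA|exact: HCE|] => x i.
rewrite (ord1 i) => x0.
transitivity ((Y *m Cb) 0 0); last by rewrite Yb mxE.
have eb z : b (fun=> z) = b (dfwith x ord0 z).
  by congr b; apply/funext => j; rewrite (ord1 j) dfwithin.
have -> : b x = b (dfwith x ord0 Y) by rewrite -x0 dfwith_id.
rewrite mxE {1}(row_sum_delta Y) alt_dfwith_sum //.
by apply: eq_bigr => j _; rewrite mxE eb.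
Qed.

(** With Y in the kernels of A, E and e, the contraction of the volume form with
    Y is a(Y) T, so that X is colinear with Y. *)
Lemma reeb_alpha X : (forall u, T (fun i => insert 0 X u i) = 0) ->
  [/\ kills X e, kills X A & kills X E].
Proof.
move=> TX; have [Y [Y0 YA YE Ye]] := kernel_vector eA; have [v Omv] := Om_neq0.
have YT : kills Y T.
  by apply: kills_wedge; [|apply: kills_wedge] => //; apply: kills_wedge_pow.
have [u|c ->] := top_form_colinear deg OmA Omv Y0 (X := X); last first.
  by split; apply: kills_scale.
rewrite [LHS](wedge1_insert _ _ aA TA) TX mulr0 (kills_iprod YT).
by rewrite wedge_vanishr // subr0.
Qed.

(** As for [reeb_alpha], with Y in the kernel of a: up to sign, the contraction
    of the volume form with Y is e(Y) (a /\ A^h /\ E^k). *)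
Lemma reeb_eta X :
  (forall u, wedge a (wedge (wedge_pow A h) (wedge_pow E k))
     (fun i => insert 0 X u i) = 0) ->
  [/\ kills X a, kills X A & kills X E].
Proof.
move=> SX; have [Y [Y0 YA YE Ya]] := kernel_vector aA; have [v Omv] := Om_neq0.
have [u|c ->] := top_form_colinear deg OmA Omv Y0 (X := X); last first.
  by split; apply: kills_scale.
(* The degrees of the two sides are equal but not convertible; on sequences the
   equality makes sense. *)
have iT (w : nat -> V) : iprod Y T (fun i => w i) =
    (-1) ^+ (h * 2) * e (fun=> Y) *
    wedge (wedge_pow A h) (wedge_pow E k) (fun i => w i).
  rewrite iprodE_gt0; last by lia.
  rewrite [LHS](wedge_insert _ _ AhA eEA); last by lia.
  rewrite (kills_iprod (kills_wedge_pow YA)) (wedge_vanishl (w := fun=> 0)) //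
    add0r.
  rewrite -mulrA; congr (_ * _); rewrite -wedgeZr.
  apply: eq_wedger => s; set x := (fun i => _); rewrite -(extendK x).
  rewrite iprodE (wedge1_insert _ _ eA EkA) (kills_iprod (kills_wedge_pow YE)).
  by rewrite wedge_vanishr // subr0.
rewrite [LHS](wedge1_insert _ _ aA TA) (Ya _ ord0) // mul0r sub0r.
have dE : (h * 2 + (1 + k * 2)).-1 = (h * 2 + k * 2)%N by lia.
pose S x := (-1) ^+ (h * 2) * e (fun=> Y) *
  wedge (wedge_pow A h) (wedge_pow E k) x.
by rewrite (wedge_castr (t' := S) a dE iT) wedgeZr SX mulr0 oppr0.
Qed.

End Contact.

End Kernels.

(** * Symmetry of second derivatives *)

Section Schwarz.
Variables (R : realType) (V : normedModType R).
Implicit Types (f : V -> R^o) (x y u v : V) (N : set V).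

Lemma is_derive_line f a u (s : R) : derivable f (a + s *: u) u ->
  is_derive s 1 (fun t : R => f (a + t *: u) : R^o) ('D_u f (a + s *: u)).
Proof.
move=> df.
have E : (fun h : R => h^-1 *:
      (((fun t : R => f (a + t *: u) : R^o) \o shift s) (h *: 1) -
       f (a + s *: u))) =
    (fun h : R => h^-1 *:
      ((f \o shift (a + s *: u)) (h *: u) - f (a + s *: u))).
  apply/funext => h /=; congr (_ *: (f _ - _)).
  by rewrite /shift /= [h *: 1]mulr1 scalerDl addrCA.
by split; rewrite /derivable /derive E.
Qed.

(** The mean value theorem in the direction u, applied to
    s |-> f(x + hv + su) - f(x + su), then in the direction v. *)
Lemma second_difference f N x u v (h : R) : 0 < h ->
  (forall s t, 0 <= s <= h -> 0 <= t <= h -> N (x + s *: u + t *: v)) ->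
  (forall y, N y -> derivable f y u) ->
  (forall y, N y -> derivable (fun z => 'D_u f z) y v) ->
  exists2 y, N y &
    f (x + h *: u + h *: v) - f (x + h *: u) - (f (x + h *: v) - f x) =
    h * h * 'D_v (fun z => 'D_u f z) y.
Proof.
move=> h0 Nx fu fuv.
have hh : 0 <= h <= h by apply/andP; split; [exact: ltW|].
have h00 : 0 <= (0 : R) <= h by apply/andP; split; [|exact: ltW].
pose phi (s : R) : R^o := f (x + h *: v + s *: u) - f (x + s *: u).
have N1 s : 0 <= s <= h -> N (x + h *: v + s *: u).
  by move=> sh; rewrite addrAC; exact: Nx.
have N2 s : 0 <= s <= h -> N (x + s *: u).
  by move=> sh; have := Nx s 0 sh h00; rewrite scale0r addr0.
have dphi s : 0 <= s <= h ->
    is_derive s 1 phi ('D_u f (x + h *: v + s *: u) - 'D_u f (x + s *: u)).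
  move=> sh; apply: is_deriveB; apply: is_derive_line; apply: fu.
    exact: N1.
  exact: N2.
have cphi : {within `[0, h], continuous phi}.
  apply: derivable_within_continuous => s; rewrite in_itv /= => sh.
  by have [] := dphi _ sh.
have dphi' s : s \in `]0, h[%R ->
    is_derive s 1 phi ('D_u f (x + h *: v + s *: u) - 'D_u f (x + s *: u)).
  by rewrite in_itv /= => /andP[s0 sh]; apply: dphi; rewrite !ltW.
have [s] := MVT h0 dphi' cphi; rewrite in_itv /= => /andP[s0 sh].
have {s0 sh} sh : 0 <= s <= h by rewrite !ltW.
rewrite subr0 => phiE.
pose psi (t : R) : R^o := 'D_u f (x + s *: u + t *: v).
have dpsi t : 0 <= t <= h ->
    is_derive t 1 psi ('D_v (fun z => 'D_u f z) (x + s *: u + t *: v)).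
  by move=> th; apply: is_derive_line; apply: fuv; exact: Nx.
have cpsi : {within `[0, h], continuous psi}.
  apply: derivable_within_continuous => t; rewrite in_itv /= => th.
  by have [] := dpsi _ th.
have dpsi' t : t \in `]0, h[%R ->
    is_derive t 1 psi ('D_v (fun z => 'D_u f z) (x + s *: u + t *: v)).
  by rewrite in_itv /= => /andP[t0 th]; apply: dpsi; rewrite !ltW.
have [t] := MVT h0 dpsi' cpsi; rewrite in_itv /= => /andP[t0 th].
have {t0 th} th : 0 <= t <= h by rewrite !ltW.
rewrite subr0 => psiE.
exists (x + s *: u + t *: v); first exact: Nx.
move: phiE psiE; rewrite /phi /psi !scale0r !addr0.
rewrite (addrAC x (h *: v) (s *: u)) => phiE psiE.
rewrite psiE in phiE; rewrite (addrAC x (h *: u)).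
by rewrite phiE -mulrA mulrC.
Qed.

(** The second difference of f in the directions u and v is symmetric in u and
    v; divided by h^2 it is close to each of the two iterated derivatives. *)
Lemma schwarz f x u v :
  (\forall y \near x, differentiable f y) ->
  (\forall y \near x, differentiable (fun z => 'D_u f z : R^o) y) ->
  (\forall y \near x, differentiable (fun z => 'D_v f z : R^o) y) ->
  {for x, continuous (fun y => 'D_v (fun z => 'D_u f z : R^o) y)} ->
  {for x, continuous (fun y => 'D_u (fun z => 'D_v f z : R^o) y)} ->
  'D_v (fun z => 'D_u f z : R^o) x = 'D_u (fun z => 'D_v f z : R^o) x.
Proof.
move=> df dfu dfv cuv cvu.
apply/eqP; rewrite -subr_eq0 -normr_le0.
apply/ler_addgt0Pl => e e0; rewrite addr0.
have close (a b c : R) : `|a - c| < e / 2 -> `|b - c| < e / 2 -> `|a - b| <= e.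
  move=> ac bc; rewrite -(subrKA c) [leRHS]splitr.
  apply: le_trans (ler_normD _ _) (lerD (ltW ac) _).
  by rewrite distrC ltW.
have sub4 (a b c d : R) : a - b - (c - d) = a - c - (b - d) by ring.
pose g1 y : R := 'D_v (fun z => 'D_u f z : R^o) y.
pose g2 y : R := 'D_u (fun z => 'D_v f z : R^o) y.
pose N := [set y | [/\ differentiable f y,
  differentiable (fun z => 'D_u f z : R^o) y,
  differentiable (fun z => 'D_v f z : R^o) y,
  `|g1 x - g1 y| < e / 2 & `|g2 x - g2 y| < e / 2]].
have : \forall y \near x, N y.
  have e20 : 0 < e / 2 by rewrite divr_gt0.
  have c2 : (g1 : V -> R^o) @ x --> (g1 x : R^o) := cuv.
  have c3 : (g2 : V -> R^o) @ x --> (g2 x : R^o) := cvu.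
  have F := nbhs_filter x.
  have {}c2 := (@cvgrPdist_lt _ _ _ _ F _ _).1 c2 _ e20.
  have {}c3 := (@cvgrPdist_lt _ _ _ _ F _ _).1 c3 _ e20.
  apply: filterS (filterI (filterI df (filterI dfu dfv)) (filterI c2 c3)).
  move=> y [[d1 [d2 d3]] [d4 d5]].
  exact: (And5 d1 d2 d3 d4 d5).
move=> /nbhs_ballP[r /= r0 rN].
(* The parallelogram at x with sides h u and h v is in the ball of radius r. *)
pose h := r / (2 * (`|u| + `|v| + 1)).
have uv0 : 0 < `|u| + `|v| + 1 by rewrite ltr_pwDr // addr_ge0.
have h0 : 0 < h by rewrite divr_gt0 // mulr_gt0.
have Nh s t : 0 <= s <= h -> 0 <= t <= h -> N (x + s *: u + t *: v).
  move=> /andP[s0 sh] /andP[t0 th]; apply: rN; rewrite -ball_normE /ball_ /=.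
  rewrite -addrA opprD addrA subrr sub0r normrN.
  apply: le_lt_trans (ler_normD _ _) _; rewrite !normrZ !ger0_norm //.
  apply: (@le_lt_trans _ _ (h * (`|u| + `|v|))).
    by rewrite mulrDr lerD // ler_wpM2r.
  apply: (@lt_le_trans _ _ (h * (2 * (`|u| + `|v| + 1)))).
    rewrite ltr_pM2l // mulr_natl mulr2n.
    by have := normr_ge0 u; have := normr_ge0 v; lra.
  by rewrite /h divfK // gt_eqF // mulr_gt0.
have Nf w y : N y -> derivable f y w by case=> d _ _ _ _; exact: diff_derivable.
have Nfu w y : N y -> derivable (fun z => 'D_u f z : R^o) y w.
  by case=> _ d _ _ _; exact: diff_derivable.
have Nfv w y : N y -> derivable (fun z => 'D_v f z : R^o) y w.
  by case=> _ _ d _ _; exact: diff_derivable.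
have [y Ny yE] := second_difference h0 Nh (Nf u) (Nfu v).
have Nh' s t : 0 <= s <= h -> 0 <= t <= h -> N (x + s *: v + t *: u).
  by move=> sh th; rewrite addrAC; exact: Nh.
have [z Nz zE] := second_difference h0 Nh' (Nf v) (Nfv u).
rewrite (addrAC x (h *: v)) in zE.
have g12 : g1 y = g2 z.
  apply: (mulfI (x := h * h)); first by rewrite mulf_neq0 // gt_eqF.
  exact: etrans (esym yE) (etrans (sub4 _ _ _ _) zE).
case: Ny => _ _ _ g1y _; case: Nz => _ _ _ _ g2z; rewrite -g12 in g2z.
exact: close g1y g2z.
Qed.

End Schwarz.

(** * The exterior derivative of a 1-form on an open set *)

Section LocalForms.
Variables (R : realType) (n : nat) (U : set 'rV[R]_n).
Local Notation V := 'rV[R]_n.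
Hypothesis U_open : open U.

Lemma near_open x : U x -> \forall y \near x, U y.
Proof. by move=> Ux; exact: open_nbhs_nbhs. Qed.

Lemma derive_eq0_on (f : V -> R^o) c x w : U x -> (forall z, U z -> f z = c) ->
  'D_w f x = 0.
Proof.
move=> Ux fc; rewrite (@near_eq_derive _ _ _ f (cst c)) ?derive_cst //.
by near=> y; apply: fc; near: y; exact: near_open.
Unshelve. all: by end_near. Qed.

(** The product rule for a pairing linear in its second argument: in coordinates
    G z (X z) is the sum of the X_j(z) G z e_j. *)
Lemma derive_pairing (G : V -> V -> R) (X : V -> V) x w : U x ->
  (forall z, U z -> forall c y u, G z (c *: y + u) = c * G z y + G z u) ->
  (forall y, differentiable (fun z => G z y : R^o) x) ->
  differentiable X x ->
  'D_w (fun z => G z (X z) : R^o) x =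
  'D_w (fun z => G z (X x) : R^o) x + G x ('D_w X x).
Proof.
move=> Ux Gl dG dX.
have G0 z : U z -> G z 0 = 0.
  by move=> Uz; have := Gl z Uz (-1) 0 0; rewrite scaler0 addr0 mulN1r addNr.
have Gsum z y : U z -> G z y = \sum_j y 0 j * G z (delta_mx 0 j).
  move=> Uz; rewrite {1}(row_sum_delta y).
  rewrite (big_morph (G z) (id1 := 0) (op1 := +%R)) => [|u v|]; last exact: G0.
    by apply: eq_bigr => j _; rewrite -[_ *: _]addr0 Gl // G0 // addr0.
  by have := Gl z Uz 1 u v; rewrite scale1r mul1r.
have dXj j : is_derive x w (fun z => X z 0 j : R^o) (('D_w X x) 0 j).
  have dXw : derivable X x w by exact: diff_derivable.
  split; first exact: (derivable_mxP X x w).1 dXw 0 j.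
  by rewrite derive_mx // mxE.
have dGj j : is_derive x w (fun z => G z (delta_mx 0 j) : R^o)
    ('D_w (fun z => G z (delta_mx 0 j) : R^o) x).
  exact/derivableP/diff_derivable/dG.
rewrite (@near_eq_derive _ _ _ _
  (\sum_j ((fun z => X z 0 j : R^o) * (fun z => G z (delta_mx 0 j) : R^o))));
  last first.
  near=> z; rewrite Gsum; last by near: z; exact: near_open.
  by rewrite fct_sumE.
rewrite [X in _ = X + _](@near_eq_derive _ _ _ _
  (\sum_j ((cst (X x 0 j) : V -> R^o) *
           (fun z => G z (delta_mx 0 j) : R^o)))); last first.
  near=> z; rewrite Gsum; last by near: z; exact: near_open.
  by rewrite fct_sumE.
rewrite !derive_val (Gsum _ _ Ux) -big_split /=; apply: eq_bigr => j _.
by rewrite scaler0 addr0 mulrC.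
Unshelve. all: by end_near. Qed.

Variable a : V -> V -> R.
Hypothesis a_lin : forall z, U z ->
  forall c y u, a z (c *: y + u) = c * a z y + a z u.
Hypothesis a_smooth : forall u, smooth_on U (fun z => a z u : R^o).

(** The exterior derivative of the 1-form a, on two constant vectors. *)
Definition dform z y u : R :=
  'D_y (fun p => a p u : R^o) z - 'D_u (fun p => a p y : R^o) z.

Lemma dformC z y u : dform z y u = - dform z u y.
Proof. by rewrite /dform opprB. Qed.

Lemma dform_lin z : U z ->
  forall c y w u, dform z (c *: y + w) u = c * dform z y u + dform z w u.
Proof.
move=> Uz c y w u; rewrite /dform.
have d v : differentiable (fun p => a p v : R^o) z
  by exact: (a_smooth v [::] Uz).
have dd v v' : derivable (fun p => a p v : R^o) z v' by exact: diff_derivable.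
have -> : 'D_(c *: y + w) (fun p => a p u : R^o) z =
    c * 'D_y (fun p => a p u : R^o) z + 'D_w (fun p => a p u : R^o) z.
  by rewrite !deriveE // linearP.
have -> : 'D_u (fun p => a p (c *: y + w) : R^o) z =
    c * 'D_u (fun p => a p y : R^o) z + 'D_u (fun p => a p w : R^o) z.
  rewrite (@near_eq_derive _ _ _ _
    (c *: (fun p => a p y : R^o) + (fun p => a p w : R^o))).
    by rewrite deriveD ?deriveZ //; exact: derivableZ.
  by near=> p; rewrite a_lin //; near: p; exact: near_open.
by rewrite opprD addrACA -mulrBr.
Unshelve. all: by end_near. Qed.

Lemma dform_differentiable z y u : U z ->
  differentiable (fun p => dform p y u : R^o) z.
Proof.
move=> Uz; apply: differentiableB.
  exact: (a_smooth u [:: y] Uz).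
exact: (a_smooth y [:: u] Uz).
Qed.

Lemma dform_derive z y u w : U z -> 'D_w (fun p => dform p y u : R^o) z =
  'D_w (fun q => 'D_y (fun p => a p u : R^o) q : R^o) z -
  'D_w (fun q => 'D_u (fun p => a p y : R^o) q : R^o) z.
Proof.
move=> Uz; rewrite -deriveB //; apply: diff_derivable.
  exact: (a_smooth u [:: y] Uz).
exact: (a_smooth y [:: u] Uz).
Qed.

Lemma smooth_schwarz (f : V -> R^o) z u v : smooth_on U f -> U z ->
  'D_v (fun q => 'D_u f q : R^o) z = 'D_u (fun q => 'D_v f q : R^o) z.
Proof.
move=> fs Uz; have near_d vs : \forall q \near z,
    differentiable (foldr (fun v (g : V -> R^o) y => 'D_v g y) f vs) q.
  by near=> q; apply: fs; near: q; exact: near_open.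
apply: schwarz.
- exact: (near_d [::]).
- exact: (near_d [:: u]).
- exact: (near_d [:: v]).
- exact: (differentiable_continuous (fs [:: v; u] z Uz)).
- exact: (differentiable_continuous (fs [:: u; v] z Uz)).
Unshelve. all: by end_near. Qed.

(** The identity d(da) = 0: the six second derivatives cancel in pairs by
    symmetry. *)
Lemma dform_closed z y u w : U z ->
  'D_w (fun p => dform p y u : R^o) z + 'D_y (fun p => dform p u w : R^o) z +
  'D_u (fun p => dform p w y : R^o) z = 0.
Proof.
have cyc (p q r : R) : p - q + (r - p) + (q - r) = 0 by ring.
move=> Uz.
rewrite (dform_derive y u w Uz) (dform_derive u w y Uz) (dform_derive w y u Uz).
rewrite (smooth_schwarz y w (a_smooth u) Uz).
rewrite (smooth_schwarz u w (a_smooth y) Uz).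
rewrite (smooth_schwarz u y (a_smooth w) Uz).
exact: cyc.
Qed.

Variables X Y : V -> V.
Hypotheses (dX : forall z, U z -> differentiable X z)
  (dY : forall z, U z -> differentiable Y z).
Let bracket z : V := 'D_(X z) Y z - 'D_(Y z) X z.

Lemma linear_fun_sub (G : V -> R) :
  (forall c y w, G (c *: y + w) = c * G y + G w) ->
  forall y w, G (y - w) = G y - G w.
Proof. by move=> Gl y w; rewrite addrC -scaleN1r Gl mulN1r addrC. Qed.

(** Differentiating da(X, v) = 0 along w gives (D_w da)(X, v) = - da(D_w X, v),
    and likewise for Y.  Hence da([X, Y], u) is
    - (D_X da)(Y, u) - (D_Y da)(u, X), that is (D_u da)(X, Y) by closedness,
    which is - da(D_u X, Y) = 0. *)
Lemma bracket_kernel x u : U x ->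
  (forall z v, U z -> dform z (X z) v = 0) ->
  (forall z v, U z -> dform z (Y z) v = 0) ->
  dform x (bracket x) u = 0.
Proof.
move=> Ux kX kY.
have D v w Z : (forall z, U z -> differentiable Z z) ->
    (forall z v, U z -> dform z (Z z) v = 0) ->
    'D_w (fun z => dform z (Z x) v : R^o) x = - dform x ('D_w Z x) v.
  move=> dZ kZ; apply/eqP; rewrite -addr_eq0; apply/eqP.
  rewrite -(derive_pairing (G := fun z y => dform z y v)) //; last exact: dZ.
  - by apply: (@derive_eq0_on _ 0) => // z Uz; exact: kZ.
  - by move=> z Uz c y w'; exact: dform_lin.
  - by move=> y; exact: dform_differentiable.
rewrite /bracket (linear_fun_sub (G := fun y => dform x y u)); last first.
  by move=> c y w; exact: dform_lin.
have := dform_closed (Y x) u (X x) Ux.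
rewrite (D u (X x) _ dY kY).
rewrite (_ : (fun p => dform p u (X x)) = - (fun p => dform p (X x) u));
  last first.
  by apply/funext => p; rewrite dformC.
rewrite deriveN; last by apply: diff_derivable; exact: dform_differentiable.
rewrite (D u (Y x) _ dX kX) opprK (D (Y x) u _ dX kX).
rewrite (dformC _ ('D_u X x)) kY // !oppr0 addr0.
by move/eqP; rewrite addrC subr_eq0 => /eqP ->; rewrite subrr.
Qed.

(** Differentiating the constants a(X) and a(Y) gives
    a([X, Y]) = (D_Y a)(X) - (D_X a)(Y) = - da(X, Y), where da(X, Y) = 0. *)
Lemma bracket_form x c d : U x ->
  (forall z v, U z -> dform z (X z) v = 0) ->
  (forall z, U z -> a z (X z) = c) -> (forall z, U z -> a z (Y z) = d) ->
  a x (bracket x) = 0.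
Proof.
move=> Ux kX aX aY.
have D w Z e : (forall z, U z -> differentiable Z z) ->
    (forall z, U z -> a z (Z z) = e) ->
    a x ('D_w Z x) = - 'D_w (fun z => a z (Z x) : R^o) x.
  move=> dZ aZ; apply/eqP; rewrite -addr_eq0 addrC; apply/eqP.
  rewrite -(derive_pairing (G := a)) //; last exact: dZ.
  - exact: (@derive_eq0_on _ e).
  - by move=> y; exact: (a_smooth y [::] Ux).
rewrite /bracket (linear_fun_sub (a_lin Ux)) (D _ _ _ dY aY) (D _ _ _ dX aX).
have := kX x (Y x) Ux; rewrite /dform => /eqP; rewrite subr_eq0 => /eqP ->.
by rewrite opprK addNr.
Qed.

End LocalForms.

(** * From local representatives to the manifold *)

Section Charts.
Variables (R : realType) (n : nat) (M : manifold R n).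
Implicit Types (al : diff_form M 1) (c : chart R M n).
Local Notation V := 'rV[R]_n.

Definition local_form al c (x u : V) : R := form_repr al c x (fun=> u).

Lemma local_form_lin al c : atlas c -> forall z, chart_im c z ->
  forall s y u, local_form al c z (s *: y + u) =
    s * local_form al c z y + local_form al c z u.
Proof.
move=> cA z zU s y u; have [al_lin _] := form_alternating al cA zU.
have := al_lin (fun=> 0) ord0 s y u.
have E t : dfwith (fun=> 0 : V) ord0 t = (fun _ : 'I_1 => t).
  by apply/funext => j; rewrite (ord1 j) dfwithin.
by rewrite !E.
Qed.

Lemma local_form_smooth al c u : atlas c ->
  smooth_on (chart_im c) (fun z => local_form al c z u : R^o).
Proof. by move=> cA; exact: form_smooth. Qed.

Lemma chart_im_open c : atlas c -> open (chart_im c).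
Proof. by case/atlas_chart. Qed.

Lemma ext_d_local al c x v :
  ext_d al c x v = dform (local_form al c) x (v ord0) (v (lift ord0 ord0)).
Proof.
have E0 : (fun j : 'I_1 => v (lift ord0 j)) = (fun=> v (lift ord0 ord0)).
  by apply/funext => j; rewrite (ord1 j).
have E1 : (fun j : 'I_1 => v (lift (lift ord0 ord0) j)) = (fun=> v ord0).
  by apply/funext => j; congr v; apply: val_inj; rewrite (ord1 j).
by rewrite /ext_d big_ord_recl big_ord1 E0 E1 expr0 mul1r expr1 mulN1r.
Qed.

Lemma bil_ext_d al c x y u :
  bil (ext_d al c x) y u = dform (local_form al c) x y u.
Proof. by rewrite /bil /= ext_d_local unlift_none liftK. Qed.

Lemma ext_d_alternating al c x : atlas c -> chart_im c x ->
  alternating_multilinear (ext_d al c x).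
Proof.
move=> cA xU; have lin := dform_lin (chart_im_open cA) (local_form_lin al cA)
  (fun u => local_form_smooth al u cA) xU.
pose i1 : 'I_2 := lift ord0 ord0.
split=> [v i s u w|v i j ij vij].
  rewrite !ext_d_local; case: (unliftP ord0 i) => [j ->|->]; last first.
    by rewrite !dfwithin !dfwithout // lin.
  rewrite (ord1 j) !dfwithin !dfwithout // ![dform _ _ (v ord0) _]dformC lin.
  by rewrite opprD mulrN.
have v01 : v ord0 = v i1.
  move: ij vij; case: (unliftP ord0 i) => [i' ->|->]; rewrite ?(ord1 i');
    case: (unliftP ord0 j) => [j' ->|->]; rewrite ?(ord1 j') ?eqxx //.
by rewrite ext_d_local v01 /dform subrr.
Qed.

Lemma form_wedge_powE p (w : form_rep M p) j c x :
  form_wedge_pow w j c x = wedge_pow (w c x) j.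
Proof. by elim: j => //= j IH; rewrite -IH. Qed.

Lemma interior_prodE (X : vec_rep M) p (w : form_rep M p) c x :
  interior_prod X w c x = iprod (X c x) (w c x).
Proof. by case: p w. Qed.

End Charts.

Theorem proposition2p3 (R : realType) (h k : nat)
    (M : manifold R (2 * h + 2 * k + 2)) (alpha eta : diff_form M 1)
    (Xa Xe : vector_field M) :
  contact_pair h k alpha eta ->
  reeb_fields h k alpha eta Xa Xe ->
  vec_eq0 (lie_bracket Xa Xe) /\
  [/\ form_eq (form_eval eta Xa) (form_cst 0),
      form_eq (interior_prod Xa (ext_d alpha)) form_zero &
      form_eq (interior_prod Xa (ext_d eta)) form_zero] /\
  [/\ form_eq (form_eval alpha Xe) (form_cst 0),
      form_eq (interior_prod Xe (ext_d alpha)) form_zero &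
      form_eq (interior_prod Xe (ext_d eta)) form_zero].
Proof.
move=> [alpha_pow eta_pow Om_neq0] [alpha_Xa iXa eta_Xe iXe].
pose A := ext_d alpha; pose E := ext_d eta.
have alphaA c x : atlas c -> chart_im c x ->
    alternating_multilinear (form_repr alpha c x).
  by move=> cA; exact: form_alternating.
have etaA c x : atlas c -> chart_im c x ->
    alternating_multilinear (form_repr eta c x).
  by move=> cA; exact: form_alternating.
have AA c x : atlas c -> chart_im c x -> alternating_multilinear (A c x).
  exact: ext_d_alternating.
have EA c x : atlas c -> chart_im c x -> alternating_multilinear (E c x).
  exact: ext_d_alternating.
have Ah c x : atlas c -> chart_im c x -> forall v, wedge_pow (A c x) h.+1 v = 0.
  by move=> cA xU v; rewrite -form_wedge_powE alpha_pow.
have Ek c x : atlas c -> chart_im c x -> forall v, wedge_pow (E c x) k.+1 v = 0.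
  by move=> cA xU v; rewrite -form_wedge_powE eta_pow.
have Om c x : atlas c -> chart_im c x -> exists v,
    wedge (form_repr alpha c x) (wedge (wedge_pow (A c x) h)
      (wedge (form_repr eta c x) (wedge_pow (E c x) k))) v != 0.
  move=> cA xU; have [v] := Om_neq0 c cA x xU.
  by rewrite -!form_wedge_powE; exists v.
have KXa c x : atlas c -> chart_im c x ->
    [/\ kills (vec_repr Xa c x) (form_repr eta c x),
        kills (vec_repr Xa c x) (A c x) & kills (vec_repr Xa c x) (E c x)].
  move=> cA xU; apply: (reeb_alpha erefl _ _ _ _ _ _ (Om c x cA xU)); auto => u.
  rewrite -iprodE_gt0; last by lia.
  by have := iXa c cA x xU (fun i => u i);
    rewrite interior_prodE -!form_wedge_powE.
have KXe c x : atlas c -> chart_im c x ->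
    [/\ kills (vec_repr Xe c x) (form_repr alpha c x),
        kills (vec_repr Xe c x) (A c x) & kills (vec_repr Xe c x) (E c x)].
  move=> cA xU; apply: (reeb_eta erefl _ _ _ _ _ _ (Om c x cA xU)); auto => u.
  rewrite -iprodE_gt0 //.
  by have := iXe c cA x xU (fun i => u i);
    rewrite interior_prodE -!form_wedge_powE.
have kills_bil (B : ('I_2 -> 'rV[R]_(2 * h + 2 * k + 2)) -> R) y u :
    kills y B -> bil B y u = 0.
  by move=> kB; rewrite /bil kills_iprod.
have i_eq0 (X : vector_field M) p (w : form_rep M p) c x v :
    kills (vec_repr X c x) (w c x) -> interior_prod X w c x v = 0.
  by move=> kw; rewrite interior_prodE kills_iprod.
split; last first.
  split; split=> c cA x xU v.
  - by have [ke _ _] := KXa c x cA xU; exact: (ke _ ord0).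
  - by apply: i_eq0; have [] := KXa c x cA xU.
  - by apply: i_eq0; have [] := KXa c x cA xU.
  - by have [ka _ _] := KXe c x cA xU; exact: (ka _ ord0).
  - by apply: i_eq0; have [] := KXe c x cA xU.
  - by apply: i_eq0; have [] := KXe c x cA xU.
move=> c cA x xU; have U_open := chart_im_open cA.
have dXa z : chart_im c z -> differentiable (vec_repr Xa c) z.
  exact: (vec_smooth Xa cA [::]).
have dXe z : chart_im c z -> differentiable (vec_repr Xe c) z.
  exact: (vec_smooth Xe cA [::]).
have kXa (al : diff_form M 1) z v : chart_im c z ->
    kills (vec_repr Xa c z) (ext_d al c z) ->
    dform (local_form al c) z (vec_repr Xa c z) v = 0.
  by move=> zU kz; rewrite -bil_ext_d kills_bil.
have kXe (al : diff_form M 1) z v : chart_im c z ->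
    kills (vec_repr Xe c z) (ext_d al c z) ->
    dform (local_form al c) z (vec_repr Xe c z) v = 0.
  by move=> zU kz; rewrite -bil_ext_d kills_bil.
(* It remains to see that the bracket is in the kernels of alpha, d alpha, eta
   and d eta. *)
set Z := lie_bracket Xa Xe c x.
have kform (al : diff_form M 1) cX cY :
    (forall z, chart_im c z -> local_form al c z (vec_repr Xa c z) = cX) ->
    (forall z, chart_im c z -> local_form al c z (vec_repr Xe c z) = cY) ->
    (forall z, chart_im c z -> kills (vec_repr Xa c z) (ext_d al c z)) ->
    kills Z (form_repr al c x).
  move=> aX aY kX v i vi; rewrite (_ : v = fun=> Z); last first.
    by apply/funext => j; rewrite -vi (ord1 i) (ord1 j).
  apply: (@bracket_form _ _ _ U_open _ (local_form_lin al cA)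
    (fun u => local_form_smooth al u cA) (vec_repr Xa c) (vec_repr Xe c)
    dXa dXe x cX cY xU) => //.
  by move=> z v' zU; apply: kXa => //; exact: kX.
have kd (al : diff_form M 1) :
    (forall z, chart_im c z -> kills (vec_repr Xa c z) (ext_d al c z)) ->
    (forall z, chart_im c z -> kills (vec_repr Xe c z) (ext_d al c z)) ->
    kills Z (ext_d al c x).
  move=> kX kY; apply: bil_kills; first exact: ext_d_alternating.
  move=> u; rewrite bil_ext_d.
  apply: (@bracket_kernel _ _ _ U_open _ (local_form_lin al cA)
    (fun u => local_form_smooth al u cA) (vec_repr Xa c) (vec_repr Xe c)
    dXa dXe x u xU).
    by move=> z v zU; apply: kXa => //; exact: kX.
  by move=> z v zU; apply: kXe => //; exact: kY.
apply: (common_kernel_eq0 erefl _ _ _ _ (Om c x cA xU)); auto.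
- apply: (kform alpha 1 0) => z zU.
  + exact: (alpha_Xa c cA z zU (fun=> 0)).
  + by have [ka _ _] := KXe c z cA zU; exact: (ka _ ord0).
  + by have [] := KXa c z cA zU.
- by apply: kd => z zU; [have [] := KXa c z cA zU|have [] := KXe c z cA zU].
- apply: (kform eta 0 1) => z zU.
  + by have [ka _ _] := KXa c z cA zU; exact: (ka _ ord0).
  + exact: (eta_Xe c cA z zU (fun=> 0)).
  + by have [] := KXa c z cA zU.
- by apply: kd => z zU; [have [] := KXa c z cA zU|have [] := KXe c z cA zU].
Qed.
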